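(* Let $c_0\in(0,1)$ be fixed, and put $r_0=1-c_0^2$, $s_0=5-4c_0^2$. Every positive and even periodic solution $\phi:\mathbb R\to\mathbb R$ of $$-\phi''+\frac{r_0}{s_0}\phi-\frac1{s_0}(\phi^3+\phi^5)=0$$ has the dnoidal profile $$\phi(x)=\frac{\sqrt{\alpha_4}\,\mathrm{dn}\left(\frac{2}{g\sqrt{3s_0}}x,k\right)}{\sqrt{1+\beta^2\,\mathrm{sn}^2\left(\frac{2}{g\sqrt{3s_0}}x,k\right)}},$$ where $\alpha_4$, $g$, $k$ and $\beta^2$ are as described in the context.
   Context: The parameter $\alpha_4$ ranges over the interval $\left(\frac{-1+\sqrt{1+4r_0}}2,\frac{-3+\sqrt{9+48r_0}}4\right)$. For such $\alpha_4$ put $q=-4\alpha_4^2-4\alpha_4+3+16r_0>0$, $\alpha_1=\frac{-2\alpha_4-3-\sqrt3\sqrt q}4$ and $\alpha_3=\frac{-2\alpha_4-3+\sqrt3\sqrt q}4$, so that $\alpha_1<0<\alpha_3<\alpha_4$. Then $g=\frac{2}{\sqrt{\alpha_4(\alpha_3-\alpha_1)}}$, $k\in(0,1)$ is given by $k^2=\frac{-\alpha_1(\alpha_4-\alpha_3)}{\alpha_4(\alpha_3-\alpha_1)}$, and $\beta^2=\frac{\alpha_4}{-\alpha_1}k^2>0$. Here $\mathrm{sn}(\cdot,k)$ and $\mathrm{dn}(\cdot,k)$ are the Jacobi elliptic functions of modulus $k$.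
   Formalization: The solution is assumed non-constant (the constant solution is a counterexample), and an even solution with its minimum at 0 is given by the dnoidal profile translated by half its fundamental period, since the stated profile always has its maximum at 0. *)

(* Defs.v *)
From Stdlib Require Import Reals ClassicalEpsilon.
From Coquelicot Require Import Coquelicot.
Open Scope R_scope.

(** Jacobi elliptic functions of modulus [k], by Legendre's amplitude. *)

Definition ellF (k theta : R) : R :=
  RInt (fun t => / sqrt (1 - k ^ 2 * sin t ^ 2)) 0 theta.

(** For [0 <= k < 1] the map [ellF k] is an increasing bijection of [R], so the
    description below picks its inverse; other moduli are not meaningful. *)
Definition am (k u : R) : R :=
  epsilon (inhabits 0) (fun theta => ellF k theta = u).

Definition sn (k u : R) : R := sin (am k u).
Definition dn (k u : R) : R := sqrt (1 - k ^ 2 * sn k u ^ 2).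

(** [a4] is the square of the maximum of the wave and [a3] that of its minimum:
    [a1], [a3], [a4] are the roots of the cubic [P] in the first integral
    [3 s0 phi'^2 = - P (phi^2)], [P y = y^3 + 3/2 y^2 - 3 r0 y + const]. *)

Definition alpha4_range (r0 a4 : R) : Prop :=
  (-1 + sqrt (1 + 4 * r0)) / 2 < a4 < (-3 + sqrt (9 + 48 * r0)) / 4.

Definition qdisc (r0 a4 : R) : R := -4 * a4 ^ 2 - 4 * a4 + 3 + 16 * r0.

Definition alpha1 (r0 a4 : R) : R :=
  (-2 * a4 - 3 - sqrt 3 * sqrt (qdisc r0 a4)) / 4.

Definition alpha3 (r0 a4 : R) : R :=
  (-2 * a4 - 3 + sqrt 3 * sqrt (qdisc r0 a4)) / 4.

Definition gpar (r0 a4 : R) : R :=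
  2 / sqrt (a4 * (alpha3 r0 a4 - alpha1 r0 a4)).

Definition kpar (r0 a4 : R) : R :=
  sqrt (- alpha1 r0 a4 * (a4 - alpha3 r0 a4)
        / (a4 * (alpha3 r0 a4 - alpha1 r0 a4))).

Definition beta2 (r0 a4 : R) : R :=
  a4 / (- alpha1 r0 a4) * kpar r0 a4 ^ 2.

Definition dnoidal (r0 s0 a4 x : R) : R :=
  let k := kpar r0 a4 in
  let u := 2 / (gpar r0 a4 * sqrt (3 * s0)) * x in
  sqrt a4 * dn k u / sqrt (1 + beta2 r0 a4 * sn k u ^ 2).

(** Both derivability clauses are needed: [Derive] is total, so derivability
    of [Derive phi] alone says nothing about [phi]. *)
Definition solution (r0 s0 : R) (phi : R -> R) : Prop :=
  (forall x, ex_derive phi x) /\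
  (forall x, ex_derive (Derive phi) x) /\
  (forall x, - Derive (Derive phi) x + r0 / s0 * phi x
             - 1 / s0 * (phi x ^ 3 + phi x ^ 5) = 0).

Definition period (phi : R -> R) (T : R) : Prop :=
  0 < T /\ forall x, phi (x + T) = phi x.

Definition fundamental_period (phi : R -> R) (L : R) : Prop :=
  period phi L /\ forall T, period phi T -> L <= T.

(* Main.v *)
(** The energy [3 s0 phi'^2 + P (phi^2)] is constant, so at every critical point
    [phi^2] is a root of one cubic. The squares of the maximum and of the minimum
    of [phi] are two distinct positive roots; since the roots sum to [-3/2], the third
    one is negative, which identifies them with [alpha4] and [alpha3] and yields the
    range of [alpha4]. The profile solves the same equation with the same data at its
    crest, so [phi] is a translate of it by uniqueness. Evenness makes [0] a critical
    point, and the profile takes its minimum exactly where [cos (am k u) = 0], that is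
    at half-periods. *)

Require Import Defs.
From Stdlib Require Import Reals Lra Lia Psatz ZArith Ranalysis5 ClassicalEpsilon.
From Coquelicot Require Import Coquelicot.
Open Scope R_scope.

(* [auto_derive] leaves eta-expanded functions under [Derive]. *)
Lemma is_derive_unique_eta (f : R -> R) (x l : R) :
  is_derive f x l -> Derive (fun y : R => f y) x = l.
Proof. apply is_derive_unique. Qed.

(** * Mean values, periodic functions, and uniqueness for second-order equations *)

Lemma mean_value (f df : R -> R) (Hf : forall x, is_derive f x (df x)) (a b : R) :
  exists c, f b - f a = df c * (b - a).
Proof.
destruct (MVT_gen f a b df) as [c [_ Hc]].
- intros x _; apply Hf.
- intros x _; apply derivable_continuous_pt; exists (df x).
  now apply is_derive_Reals.
- now exists c.
Qed.

Lemma zero_derive_const (f : R -> R) (Hf : forall x, is_derive f x 0) (a b : R) :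
  f a = f b.
Proof.
destruct (mean_value f (fun _ => 0) Hf a b) as [c Hc]; lra.
Qed.

Lemma periodic_IZR (f : R -> R) (T : R) (HT : forall x, f (x + T) = f x)
  (n : Z) (x : R) : f (x + IZR n * T) = f x.
Proof.
assert (Hnat : forall m y, f (y + INR m * T) = f y).
{ intros m; induction m as [|m IH]; intros y.
  - simpl; f_equal; ring.
  - rewrite S_INR, <- (IH y), <- (HT (y + INR m * T)); f_equal; ring. }
destruct (Z_le_gt_dec 0 n) as [Hn|Hn].
- rewrite <- (Z2Nat.id n Hn), <- INR_IZR_INZ; apply Hnat.
- rewrite <- (Hnat (Z.to_nat (- n)) (x + IZR n * T)); f_equal.
  rewrite INR_IZR_INZ, Z2Nat.id, opp_IZR by lia; ring.
Qed.

(** Gronwall's argument for the squared distance [E] of the two trajectories in phase space, which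
    satisfies [|E'| <= (1 + K) E]. The Lipschitz bound is asked for only on a set [I] containing
    both solutions, since the quintic nonlinearity is not globally Lipschitz. *)
Lemma ode_unique (F : R -> R) (I : R -> Prop) (K : R) (HK : 0 <= K)
  (HF : forall a b, I a -> I b -> Rabs (F a - F b) <= K * Rabs (a - b))
  (u du v dv : R -> R)
  (Hu : forall x, is_derive u x (du x)) (Hdu : forall x, is_derive du x (F (u x)))
  (Hv : forall x, is_derive v x (dv x)) (Hdv : forall x, is_derive dv x (F (v x)))
  (Iu : forall x, I (u x)) (Iv : forall x, I (v x))
  (H0 : u 0 = v 0) (H1 : du 0 = dv 0) (x : R) : u x = v x.
Proof.
pose (E := fun t => (u t - v t) ^ 2 + (du t - dv t) ^ 2).
pose (dE := fun t => 2 * (u t - v t) * (du t - dv t)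
                     + 2 * (du t - dv t) * (F (u t) - F (v t))).
assert (HE : forall t, is_derive E t (dE t)).
{ intros t; unfold E, dE; auto_derive.
  - repeat split; eexists; eauto.
  - rewrite (is_derive_unique_eta _ _ _ (Hu t)), (is_derive_unique_eta _ _ _ (Hv t)),
      (is_derive_unique_eta _ _ _ (Hdu t)), (is_derive_unique_eta _ _ _ (Hdv t)); ring. }
assert (Hbd : forall t, Rabs (dE t) <= (1 + K) * E t).
{ intros t; specialize (HF _ _ (Iu t) (Iv t)); unfold dE, E.
  rewrite <- (pow2_abs (u t - v t)), <- (pow2_abs (du t - dv t)).
  eapply Rle_trans; [apply Rabs_triang|].
  rewrite !Rabs_mult, (Rabs_pos_eq 2) by lra.
  pose proof (Rabs_pos (u t - v t)); pose proof (Rabs_pos (du t - dv t)).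
  set (w := Rabs (u t - v t)) in *; set (z := Rabs (du t - dv t)) in *.
  assert (z * Rabs (F (u t) - F (v t)) <= z * (K * w)) by nra.
  (* The cross term [2 w z] is absorbed by [w ^ 2 + z ^ 2]. *)
  pose proof (pow2_ge_0 (w - z)).
  assert (K * (2 * (w * z)) <= K * (w ^ 2 + z ^ 2))
    by (apply Rmult_le_compat_l; nra).
  nra. }
assert (E0 : E 0 = 0) by (unfold E; rewrite H0, H1; ring).
(* With [c = - (1 + K)] the weighted distance is nonincreasing, which settles [x >= 0]; with
   [c = 1 + K] it is nondecreasing, which settles [x < 0]. *)
assert (HG : forall c t, is_derive (fun t => E t * exp (c * t)) t
                           ((dE t + c * E t) * exp (c * t))).
{ intros c t; auto_derive.
  - eexists; eauto.
  - rewrite (is_derive_unique_eta _ _ _ (HE t)); ring. }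
assert (Ex : E x <= 0).
{ destruct (Rle_dec 0 x) as [Hx|Hx].
  - destruct (mean_value _ _ (HG (- (1 + K))) 0 x) as [t Ht].
    rewrite E0 in Ht.
    pose proof (Rle_abs (dE t)); specialize (Hbd t).
    pose proof (exp_pos (- (1 + K) * t)); pose proof (exp_pos (- (1 + K) * x)).
    assert (0 <= (- dE t + (1 + K) * E t) * exp (- (1 + K) * t) * (x - 0))
      by (apply Rmult_le_pos; [apply Rmult_le_pos|]; lra).
    nra.
  - destruct (mean_value _ _ (HG (1 + K)) 0 x) as [t Ht].
    rewrite E0 in Ht.
    pose proof (Rabs_maj2 (dE t)); specialize (Hbd t).
    pose proof (exp_pos ((1 + K) * t)); pose proof (exp_pos ((1 + K) * x)).
    assert (0 <= (dE t + (1 + K) * E t) * exp ((1 + K) * t) * (0 - x))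
      by (apply Rmult_le_pos; [apply Rmult_le_pos|]; lra).
    nra. }
unfold E in Ex; pose proof (pow2_ge_0 (du x - dv x)); nra.
Qed.

(** * Legendre's integral of the first kind and its inverse, the amplitude *)

Lemma one_sub_sin_pos (k t : R) (Hk : k ^ 2 < 1) : 0 < 1 - k ^ 2 * sin t ^ 2.
Proof.
pose proof (SIN_bound t); pose proof (pow2_ge_0 k).
pose proof (pow2_ge_0 (cos t)); pose proof (sin2_cos2 t); unfold Rsqr in *; nra.
Qed.

Lemma is_derive_ellF (k t : R) (Hk : k ^ 2 < 1) :
  is_derive (ellF k) t (/ sqrt (1 - k ^ 2 * sin t ^ 2)).
Proof.
assert (Hc : forall s, continuous (fun t => / sqrt (1 - k ^ 2 * sin t ^ 2)) s).
{ intros s; apply (ex_derive_continuous (V := R_NormedModule)); auto_derive.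
  pose proof (one_sub_sin_pos k s Hk); pose proof (sqrt_lt_R0 _ H).
  replace (1 + - (k * (k * 1) * (sin s * (sin s * 1))))
    with (1 - k ^ 2 * sin s ^ 2) by ring.
  repeat split; lra. }
apply (is_derive_RInt (V := R_NormedModule)
         (fun t => / sqrt (1 - k ^ 2 * sin t ^ 2)) (ellF k) 0 t).
- apply filter_forall; intros s; apply (RInt_correct (V := R_CompleteNormedModule)).
  apply (ex_RInt_continuous (V := R_CompleteNormedModule)); intros; apply Hc.
- apply Hc.
Qed.

Lemma ellF_0 (k : R) : ellF k 0 = 0.
Proof. exact (RInt_point (V := R_CompleteNormedModule) 0 _). Qed.

(** The integrand is at least [1]. This one bound yields surjectivity and injectivity of [ellF k],
    and monotonicity and continuity of its inverse. *)
Lemma ellF_expanding (k a b : R) (Hk : k ^ 2 < 1) (Hab : a <= b) :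
  b - a <= ellF k b - ellF k a.
Proof.
destruct (mean_value _ _ (fun t => is_derive_ellF k t Hk) a b) as [c Hc].
rewrite Hc.
pose proof (one_sub_sin_pos k c Hk) as Hp.
assert (1 <= / sqrt (1 - k ^ 2 * sin c ^ 2)).
{ rewrite <- Rinv_1 at 1; apply Rinv_le_contravar; [now apply sqrt_lt_R0|].
  rewrite <- sqrt_1 at 2; apply sqrt_le_1_alt.
  pose proof (Rmult_le_pos _ _ (pow2_ge_0 k) (pow2_ge_0 (sin c))); lra. }
nra.
Qed.

Lemma ellF_opp (k t : R) (Hk : k ^ 2 < 1) : ellF k (- t) = - ellF k t.
Proof.
assert (H : ellF k t + ellF k (- t) = ellF k 0 + ellF k (- 0)).
{ apply (zero_derive_const (fun t => ellF k t + ellF k (- t))); intros x.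
  pose proof (is_derive_ellF k x Hk); pose proof (is_derive_ellF k (- x) Hk).
  auto_derive.
  - repeat split; eexists; eauto.
  - rewrite (is_derive_unique_eta _ _ _ H), (is_derive_unique_eta _ _ _ H0), sin_neg.
    replace ((- sin x) ^ 2) with (sin x ^ 2) by ring; ring. }
rewrite Ropp_0, !ellF_0 in H; lra.
Qed.

Lemma ellF_add_PI (k t : R) (Hk : k ^ 2 < 1) :
  ellF k (t + PI) = ellF k t + 2 * ellF k (PI / 2).
Proof.
(* The difference is constant in [t]; at [- (PI / 2)] oddness evaluates it. *)
assert (H : ellF k (t + PI) - ellF k t
            = ellF k (- (PI / 2) + PI) - ellF k (- (PI / 2))).
{ apply (zero_derive_const (fun t => ellF k (t + PI) - ellF k t)); intros x.
  pose proof (is_derive_ellF k x Hk); pose proof (is_derive_ellF k (x + PI) Hk).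
  auto_derive.
  - repeat split; eexists; eauto.
  - rewrite (is_derive_unique_eta _ _ _ H), (is_derive_unique_eta _ _ _ H0), neg_sin.
    replace ((- sin x) ^ 2) with (sin x ^ 2) by ring; ring. }
rewrite (ellF_opp k (PI / 2) Hk) in H.
replace (- (PI / 2) + PI) with (PI / 2) in H by lra; lra.
Qed.

(** Subtracting the right linear function from [ellF k] leaves a [PI]-periodic function, so the case
    of one period extends to all integers. *)
Lemma ellF_add_IZR_PI (k t : R) (n : Z) (Hk : k ^ 2 < 1) :
  ellF k (t + IZR n * PI) = ellF k t + IZR n * (2 * ellF k (PI / 2)).
Proof.
pose proof PI_RGT_0.
pose proof (periodic_IZR (fun s => ellF k s - 2 * ellF k (PI / 2) * (s / PI)) PI) as P.
cbv beta in P.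
rewrite <- (Rplus_0_r (ellF k (t + IZR n * PI))).
enough (ellF k (t + IZR n * PI) - 2 * ellF k (PI / 2) * ((t + IZR n * PI) / PI)
        = ellF k t - 2 * ellF k (PI / 2) * (t / PI)) as Q.
{ replace ((t + IZR n * PI) / PI) with (t / PI + IZR n) in Q by (field; lra); lra. }
apply P; intros s; rewrite ellF_add_PI by assumption; field; lra.
Qed.

(** The choice in [am] is meaningful once [u] has a preimage: expansion and oddness put [u] between
    the values of [ellF k] at [- Rabs u] and [Rabs u], and the intermediate value theorem
    applies. *)
Lemma ellF_am (k u : R) (Hk : k ^ 2 < 1) : ellF k (am k u) = u.
Proof.
unfold am; apply epsilon_spec.
pose proof (Rabs_pos u) as Hp.
pose proof (ellF_expanding k 0 (Rabs u) Hk Hp) as H; rewrite ellF_0 in H.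
destruct (IVT_gen (ellF k) (- Rabs u) (Rabs u) u) as [t [_ Ht]].
- intros t; apply derivable_continuous_pt; eexists.
  apply is_derive_Reals; now apply is_derive_ellF.
- rewrite ellF_opp by assumption.
  pose proof (Rle_abs u); pose proof (Rabs_maj2 u).
  rewrite Rmin_left, Rmax_right; lra.
- now exists t.
Qed.

Lemma ellF_inj (k a b : R) (Hk : k ^ 2 < 1) : ellF k a = ellF k b -> a = b.
Proof.
intros H; destruct (Rle_dec a b) as [L|L].
- pose proof (ellF_expanding k a b Hk L); lra.
- pose proof (ellF_expanding k b a Hk ltac:(lra)); lra.
Qed.

Lemma am_ellF (k t : R) (Hk : k ^ 2 < 1) : am k (ellF k t) = t.
Proof. apply (ellF_inj k); [|apply ellF_am]; assumption. Qed.

Lemma am_contracting (k u v : R) (Hk : k ^ 2 < 1) :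
  Rabs (am k u - am k v) <= Rabs (u - v).
Proof.
assert (H : forall u v, am k u <= am k v -> am k v - am k u <= v - u).
{ intros a b L; pose proof (ellF_expanding k _ _ Hk L).
  now rewrite !ellF_am in H. }
destruct (Rle_dec (am k u) (am k v)) as [L|L].
- pose proof (H _ _ L); rewrite !Rabs_left1; lra.
- pose proof (H v u ltac:(lra)); rewrite !Rabs_pos_eq; lra.
Qed.

Lemma am_le (k u v : R) (Hk : k ^ 2 < 1) : u <= v -> am k u <= am k v.
Proof.
intros L; destruct (Rle_dec (am k u) (am k v)) as [H|H]; [exact H|].
pose proof (ellF_expanding k (am k v) (am k u) Hk ltac:(lra)) as P.
rewrite !ellF_am in P by assumption; lra.
Qed.

(** Derivative of an inverse function: the reciprocal of the integrand at [am k u] is [dn k u]. *)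
Lemma is_derive_am (k u : R) (Hk : k ^ 2 < 1) : is_derive (am k) u (dn k u).
Proof.
pose proof (sqrt_lt_R0 _ (one_sub_sin_pos k (am k u) Hk)) as Hs.
assert (Hd : forall t, derivable_pt_lim (ellF k) t (/ sqrt (1 - k ^ 2 * sin t ^ 2)))
  by (intros t; apply is_derive_Reals; now apply is_derive_ellF).
(* The derivability proof is an explicit pair, so that [derive_pt] reduces to its first component by
   [reflexivity]. *)
pose (Prf := fun a (_ : am k (u - 1) <= a <= am k (u + 1)) =>
               exist _ _ (Hd a) : derivable_pt (ellF k) a).
assert (Hc : continuity_pt (am k) u).
{ intros e He; exists e; split; [exact He|].
  intros v [_ Hv]; eapply Rle_lt_trans; [|exact Hv].
  now apply am_contracting. }
assert (Hu : am k (u - 1) <= am k u <= am k (u + 1))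
  by (split; apply am_le; lra).
assert (HPrf : derive_pt (ellF k) (am k u) (Prf _ Hu)
               = / sqrt (1 - k ^ 2 * sin (am k u) ^ 2)) by reflexivity.
apply is_derive_Reals.
replace (dn k u) with (1 / derive_pt (ellF k) (am k u) (Prf _ Hu)).
- apply derivable_pt_lim_recip_interv; try lra.
  + exact Hc.
  + intros; now apply ellF_am.
  + rewrite HPrf; apply Rinv_neq_0_compat; lra.
- rewrite HPrf; unfold dn, sn; field; lra.
Qed.

Lemma am_0 (k : R) (Hk : k ^ 2 < 1) : am k 0 = 0.
Proof. rewrite <- (ellF_0 k) at 1; now apply am_ellF. Qed.

Lemma am_add_period (k u : R) (Hk : k ^ 2 < 1) :
  am k (u + 2 * ellF k (PI / 2)) = am k u + PI.
Proof.
rewrite <- (ellF_am k u Hk) at 1; rewrite <- ellF_add_PI by assumption.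
now apply am_ellF.
Qed.

Lemma lt_sqrt_of_pow2_lt (x y : R) (Hx : 0 <= x) (H : x ^ 2 < y) : x < sqrt y.
Proof.
rewrite <- (sqrt_pow2 x Hx); apply sqrt_lt_1_alt; split; [apply pow2_ge_0|exact H].
Qed.

Lemma sqrt_lt_of_lt_pow2 (x y : R) (Hx : 0 < x) (H : y < x ^ 2) : sqrt y < x.
Proof.
destruct (Rle_dec 0 y) as [Hy|Hy].
- rewrite <- (sqrt_pow2 x) by lra; apply sqrt_lt_1_alt; lra.
(* At negative arguments [sqrt] has the default value [0]. *)
- rewrite sqrt_neg_0; lra.
Qed.

(** * Jacobi functions and the first two derivatives of the unscaled profile *)

Lemma sn_sqr_bounds (k u : R) : 0 <= sn k u ^ 2 <= 1.
Proof.
unfold sn; split; [apply pow2_ge_0|].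
pose proof (pow2_ge_0 (cos (am k u))); pose proof (sin2_cos2 (am k u)).
unfold Rsqr in *; lra.
Qed.

Definition cn (k u : R) : R := cos (am k u).

Lemma cn_sqr (k u : R) : cn k u ^ 2 = 1 - sn k u ^ 2.
Proof.
unfold cn, sn; pose proof (sin2_cos2 (am k u)); unfold Rsqr in *; lra.
Qed.

Lemma dn_pos (k u : R) (Hk : k ^ 2 < 1) : 0 < dn k u.
Proof. apply sqrt_lt_R0, one_sub_sin_pos, Hk. Qed.

Lemma dn_sqr (k u : R) (Hk : k ^ 2 < 1) : dn k u ^ 2 = 1 - k ^ 2 * sn k u ^ 2.
Proof. apply pow2_sqrt; apply Rlt_le, one_sub_sin_pos, Hk. Qed.

Lemma is_derive_sn (k u : R) (Hk : k ^ 2 < 1) :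
  is_derive (sn k) u (cn k u * dn k u).
Proof.
pose proof (is_derive_am k u Hk) as H; unfold sn; auto_derive.
- now exists (dn k u).
- rewrite (is_derive_unique_eta _ _ _ H); unfold cn; ring.
Qed.

Lemma is_derive_cn (k u : R) (Hk : k ^ 2 < 1) :
  is_derive (cn k) u (- (sn k u * dn k u)).
Proof.
pose proof (is_derive_am k u Hk) as H; unfold cn; auto_derive.
- now exists (dn k u).
- rewrite (is_derive_unique_eta _ _ _ H); unfold sn; ring.
Qed.

(** Serves both square roots of the profile: [c = - k ^ 2] gives [dn], and [c = b] gives the
    denominator. *)
Lemma is_derive_sqrt_sn (k c u : R) (Hk : k ^ 2 < 1) (Hc : 0 < 1 + c * sn k u ^ 2) :
  is_derive (fun u => sqrt (1 + c * sn k u ^ 2)) u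
    (c * sn k u * cn k u * dn k u / sqrt (1 + c * sn k u ^ 2)).
Proof.
pose proof (is_derive_sn k u Hk) as H; pose proof (sqrt_lt_R0 _ Hc) as Hs.
auto_derive.
- split; [now eexists; eauto|]; simpl in Hc; lra.
- rewrite (is_derive_unique_eta _ _ _ H).
  change (sn k u * (sn k u * 1)) with (sn k u ^ 2); field; lra.
Qed.

Lemma is_derive_dn (k u : R) (Hk : k ^ 2 < 1) :
  is_derive (dn k) u (- k ^ 2 * sn k u * cn k u).
Proof.
pose proof (one_sub_sin_pos k (am k u) Hk) as Hp; change (sin _) with (sn k u) in Hp.
pose proof (dn_pos k u Hk) as Hd.
apply (is_derive_ext (fun u => sqrt (1 + - k ^ 2 * sn k u ^ 2))).
{ intros t; unfold dn; f_equal; ring. }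
replace (- k ^ 2 * sn k u * cn k u) with
  (- k ^ 2 * sn k u * cn k u * dn k u / sqrt (1 + - k ^ 2 * sn k u ^ 2)).
- apply is_derive_sqrt_sn; [exact Hk|lra].
- replace (sqrt (1 + - k ^ 2 * sn k u ^ 2)) with (dn k u)
    by (unfold dn; f_equal; ring).
  field; lra.
Qed.

Lemma one_add_sn_ge1 (b k u : R) (Hb : 0 <= b) : 1 <= 1 + b * sn k u ^ 2.
Proof. pose proof (sn_sqr_bounds k u); nra. Qed.

(* Quotient rule for [dn / q], [q = sqrt (1 + b sn^2)]: the numerators combine as
   [k^2 q^2 + b dn^2 = k^2 + b]. *)
Lemma is_derive_dn_ratio (b k u : R) (Hk : k ^ 2 < 1) (Hb : 0 <= b) :
  is_derive (fun u => dn k u / sqrt (1 + b * sn k u ^ 2)) u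
    (- (k ^ 2 + b) * (sn k u * cn k u) / sqrt (1 + b * sn k u ^ 2) ^ 3).
Proof.
pose proof (one_add_sn_ge1 b k u Hb) as H1.
pose (q := fun u => sqrt (1 + b * sn k u ^ 2)).
assert (Hq : is_derive q u (b * sn k u * cn k u * dn k u / q u))
  by (apply is_derive_sqrt_sn; lra).
pose proof (is_derive_dn k u Hk) as Hd.
pose proof (sqrt_lt_R0 (1 + b * sn k u ^ 2) ltac:(lra)) as Hs.
pose proof (pow2_sqrt (1 + b * sn k u ^ 2) ltac:(lra)) as E2.
pose proof (dn_sqr k u Hk) as E1.
change (sqrt (1 + b * sn k u ^ 2)) with (q u) in *.
change (is_derive (fun u => dn k u / q u) u
          (- (k ^ 2 + b) * (sn k u * cn k u) / q u ^ 3)).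
auto_derive.
- repeat split; try (eexists; eauto); lra.
- rewrite (is_derive_unique_eta _ _ _ Hd), (is_derive_unique_eta _ _ _ Hq).
  replace (k ^ 2 + b) with (k ^ 2 * q u ^ 2 + b * dn k u ^ 2)
    by (rewrite E1, E2; ring).
  field; lra.
Qed.

(** The result is a rational function of [S] times the profile itself, the shape in which the
    equation can be divided by the profile. *)
Lemma is_derive_dn_ratio2 (b k u : R) (Hk : k ^ 2 < 1) (Hb : 0 <= b) :
  let S := sn k u ^ 2 in
  is_derive (fun u => - (k ^ 2 + b) * (sn k u * cn k u) / sqrt (1 + b * sn k u ^ 2) ^ 3) u
    (- (k ^ 2 + b) * (1 - 2 * S - 2 * b * S + b * S ^ 2) / (1 + b * S) ^ 2
       * (dn k u / sqrt (1 + b * S))).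
Proof.
intros S.
pose proof (one_add_sn_ge1 b k u Hb) as H1.
pose (q := fun u => sqrt (1 + b * sn k u ^ 2)).
assert (Hq : is_derive q u (b * sn k u * cn k u * dn k u / q u))
  by (apply is_derive_sqrt_sn; lra).
pose proof (is_derive_sn k u Hk) as Hsn.
pose proof (is_derive_cn k u Hk) as Hcn.
pose proof (sqrt_lt_R0 (1 + b * sn k u ^ 2) ltac:(lra)) as Hs.
pose proof (pow2_sqrt (1 + b * sn k u ^ 2) ltac:(lra)) as E2.
pose proof (cn_sqr k u) as E1.
change (sqrt (1 + b * sn k u ^ 2)) with (q u) in *.
fold S in E1, E2.
change (is_derive (fun u => - (k ^ 2 + b) * (sn k u * cn k u) / q u ^ 3) u
  (- (k ^ 2 + b) * (1 - 2 * S - 2 * b * S + b * S ^ 2) / (1 + b * S) ^ 2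
       * (dn k u / q u))).
(* The first term comes from differentiating [sn * cn], the second from differentiating the inverse
   cube of [q]. *)
replace (1 - 2 * S - 2 * b * S + b * S ^ 2)
  with ((cn k u ^ 2 - sn k u ^ 2) * q u ^ 2 - 3 * b * sn k u ^ 2 * cn k u ^ 2)
  by (rewrite E1, E2; unfold S; ring).
rewrite <- E2.
auto_derive.
- repeat split; try (eexists; eauto); try lra.
  assert (0 < q u ^ 3) by (apply pow_lt; lra); simpl in *; lra.
- rewrite (is_derive_unique_eta _ _ _ Hsn), (is_derive_unique_eta _ _ _ Hcn),
    (is_derive_unique_eta _ _ _ Hq).
  field; lra.
Qed.

(** * The roots of the cubic and the parameters built from them *)

(** The two equations are Vieta's relations. After squaring, [alpha3 < a4] becomes [r < a4 ^ 2 + a4]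
    and [0 < alpha3] becomes [2 * a4 ^ 2 + 3 * a4 < 6 * r]; these are the lower and the upper end of
    the range. *)
Lemma alpha_relations (r a4 : R) (Hr : 0 < r) (Ha : alpha4_range r a4) :
  alpha1 r a4 < 0 < alpha3 r a4 /\ alpha3 r a4 < a4 /\
  alpha1 r a4 + alpha3 r a4 + a4 = - (3 / 2) /\
  alpha1 r a4 * alpha3 r a4 + (alpha1 r a4 + alpha3 r a4) * a4 = - 3 * r.
Proof.
destruct Ha as [Hlo Hhi].
pose proof (lt_sqrt_of_pow2_lt 1 (1 + 4 * r) ltac:(lra) ltac:(lra)) as H1.
pose proof (pow2_sqrt (1 + 4 * r) ltac:(lra)) as E1.
pose proof (pow2_sqrt (9 + 48 * r) ltac:(lra)) as E2.
set (u := sqrt (1 + 4 * r)) in *; set (v := sqrt (9 + 48 * r)) in *.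
assert (r < a4 ^ 2 + a4) by nra.
assert (2 * a4 ^ 2 + 3 * a4 < 6 * r) by nra.
assert (Hq : 0 < qdisc r a4) by (unfold qdisc; nra).
assert (Et : (sqrt 3 * sqrt (qdisc r a4)) ^ 2 = 3 * qdisc r a4)
  by (rewrite Rpow_mult_distr, !pow2_sqrt; lra).
assert (Ht : 0 < sqrt 3 * sqrt (qdisc r a4))
  by (apply Rmult_lt_0_compat; apply sqrt_lt_R0; lra).
unfold alpha1, alpha3.
set (t := sqrt 3 * sqrt (qdisc r a4)) in *; unfold qdisc in Et.
repeat split; try nra.
Qed.

Lemma kpar_sqr (r a4 : R) (Hr : 0 < r) (Ha : alpha4_range r a4) :
  kpar r a4 ^ 2 = - alpha1 r a4 * (a4 - alpha3 r a4) / (a4 * (alpha3 r a4 - alpha1 r a4)).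
Proof.
destruct (alpha_relations r a4 Hr Ha) as (H1 & H2 & _).
apply pow2_sqrt, Rlt_le, Rdiv_lt_0_compat; apply Rmult_lt_0_compat; lra.
Qed.

(** Denominator minus numerator equals [alpha3 * (a4 - alpha1)], which is positive. *)
Lemma kpar_sqr_lt1 (r a4 : R) (Hr : 0 < r) (Ha : alpha4_range r a4) :
  kpar r a4 ^ 2 < 1.
Proof.
destruct (alpha_relations r a4 Hr Ha) as (H1 & H2 & _).
rewrite kpar_sqr by assumption.
apply Rlt_div_l; [apply Rmult_lt_0_compat; lra|nra].
Qed.

Lemma beta2_eq (r a4 : R) (Hr : 0 < r) (Ha : alpha4_range r a4) :
  beta2 r a4 = (a4 - alpha3 r a4) / (alpha3 r a4 - alpha1 r a4).
Proof.
destruct (alpha_relations r a4 Hr Ha) as (H1 & H2 & _).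
unfold beta2; rewrite kpar_sqr by assumption; field; lra.
Qed.

Lemma beta2_pos (r a4 : R) (Hr : 0 < r) (Ha : alpha4_range r a4) : 0 < beta2 r a4.
Proof.
destruct (alpha_relations r a4 Hr Ha) as (H1 & H2 & _).
rewrite beta2_eq by assumption; apply Rdiv_lt_0_compat; lra.
Qed.

Definition freq (r s a4 : R) : R := 2 / (gpar r a4 * sqrt (3 * s)).

Lemma gpar_pos (r a4 : R) (Hr : 0 < r) (Ha : alpha4_range r a4) : 0 < gpar r a4.
Proof.
destruct (alpha_relations r a4 Hr Ha) as (H1 & H2 & _).
apply Rdiv_lt_0_compat; [lra|]; apply sqrt_lt_R0, Rmult_lt_0_compat; lra.
Qed.

Lemma freq_pos (r s a4 : R) (Hr : 0 < r) (Hs : 0 < s) (Ha : alpha4_range r a4) :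
  0 < freq r s a4.
Proof.
apply Rdiv_lt_0_compat; [lra|]; apply Rmult_lt_0_compat.
- now apply gpar_pos.
- apply sqrt_lt_R0; lra.
Qed.

Lemma freq_sqr (r s a4 : R) (Hr : 0 < r) (Hs : 0 < s) (Ha : alpha4_range r a4) :
  freq r s a4 ^ 2 = a4 * (alpha3 r a4 - alpha1 r a4) / (3 * s).
Proof.
destruct (alpha_relations r a4 Hr Ha) as (H1 & H2 & _).
assert (Hp : 0 < a4 * (alpha3 r a4 - alpha1 r a4)) by (apply Rmult_lt_0_compat; lra).
unfold freq, gpar.
pose proof (pow2_sqrt _ (Rlt_le _ _ Hp)) as E1; pose proof (sqrt_lt_R0 _ Hp).
pose proof (pow2_sqrt (3 * s) ltac:(lra)) as E2.
pose proof (sqrt_lt_R0 (3 * s) ltac:(lra)).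
set (p := sqrt (a4 * _)) in *; set (q := sqrt (3 * s)) in *.
rewrite <- E1, <- E2; field; lra.
Qed.

(** * The dnoidal profile: equation, bounds, period, crests and troughs *)

Lemma dnoidal_profile (r s a4 x : R) :
  dnoidal r s a4 x = sqrt a4 *
    (dn (kpar r a4) (freq r s a4 * x)
     / sqrt (1 + beta2 r a4 * sn (kpar r a4) (freq r s a4 * x) ^ 2)).
Proof. unfold dnoidal, freq, Rdiv; ring. Qed.

Lemma dn_ratio_sqr (b k u : R) (Hk : k ^ 2 < 1) (Hb : 0 <= b) :
  (dn k u / sqrt (1 + b * sn k u ^ 2)) ^ 2
  = (1 - k ^ 2 * sn k u ^ 2) / (1 + b * sn k u ^ 2).
Proof.
pose proof (one_add_sn_ge1 b k u Hb).
unfold Rdiv; rewrite Rpow_mult_distr, pow_inv, pow2_sqrt, dn_sqr; lra.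
Qed.

(** The equation solved for the second derivative: [phi'' = accel r s phi]. *)
Definition accel (r s y : R) : R := (r * y - (y ^ 3 + y ^ 5)) / s.

(** The algebraic core of the profile equation, divided by the profile: [y] is the squared profile
    and [S] stands for [sn ^ 2]. Eliminating [A] through the sum of the roots leaves a rational
    identity in [B], [C] and [S]; the sign conditions keep the denominators nonzero. *)
Lemma dn_ratio_accel (A B C S : R) (HA : A < 0 < B) (HB : B < C)
  (HS : A + B + C = - (3 / 2)) (hS : 0 <= S) :
  let r := - (A * B + (A + B) * C) / 3 in
  let k2 := - A * (C - B) / (C * (B - A)) in
  let b := (C - B) / (B - A) in
  let y := C * ((1 - k2 * S) / (1 + b * S)) in
  C * (B - A) / 3 * (- (k2 + b) * (1 - 2 * S - 2 * b * S + b * S ^ 2) / (1 + b * S) ^ 2)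
  = r - y - y ^ 2.
Proof.
intros r k2 b y; unfold y, r, k2, b.
replace A with (- (3 / 2) - B - C) in * by lra.
field; repeat split; nra.
Qed.

Lemma dnoidal_ode (r s a4 : R) (Hr : 0 < r) (Hs : 0 < s) (Ha : alpha4_range r a4) :
  exists dD : R -> R, (forall x, is_derive (dnoidal r s a4) x (dD x)) /\
    (forall x, is_derive dD x (accel r s (dnoidal r s a4 x))) /\ dD 0 = 0.
Proof.
pose proof (alpha_relations r a4 Hr Ha) as (H1 & H2 & H3 & H4).
pose proof (kpar_sqr_lt1 r a4 Hr Ha) as Hk.
pose proof (beta2_pos r a4 Hr Ha) as Hb; apply Rlt_le in Hb.
pose proof (kpar_sqr r a4 Hr Ha) as Ek; pose proof (beta2_eq r a4 Hr Ha) as Eb.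
pose proof (freq_sqr r s a4 Hr Hs Ha) as Ew.
pose proof (dnoidal_profile r s a4) as HD.
set (k := kpar r a4) in *; set (b := beta2 r a4) in *; set (w := freq r s a4) in *.
pose (f := fun u => dn k u / sqrt (1 + b * sn k u ^ 2)).
pose (f1 := fun u => - (k ^ 2 + b) * (sn k u * cn k u) / sqrt (1 + b * sn k u ^ 2) ^ 3).
pose (c := fun S => - (k ^ 2 + b) * (1 - 2 * S - 2 * b * S + b * S ^ 2) / (1 + b * S) ^ 2).
assert (Hf : forall u, is_derive f u (f1 u)) by (intros u; now apply is_derive_dn_ratio).
assert (Hf1 : forall u, is_derive f1 u (c (sn k u ^ 2) * f u))
  by (intros u; now apply is_derive_dn_ratio2).
exists (fun x => sqrt a4 * w * f1 (w * x)); split; [|split].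
- intros x; apply (is_derive_ext (fun x => sqrt a4 * f (w * x))).
  { intros t; symmetry; apply HD. }
  auto_derive; [eexists; eauto|].
  rewrite (is_derive_unique_eta _ _ _ (Hf _)); ring.
- intros x; rewrite HD; fold (f (w * x)).
  pose proof (dn_ratio_sqr b k (w * x) Hk Hb) as Ef; fold (f (w * x)) in Ef.
  auto_derive; [eexists; eauto|].
  rewrite (is_derive_unique_eta _ _ _ (Hf1 _)).
  pose proof (dn_ratio_accel _ _ _ (sn k (w * x) ^ 2) H1 H2 H3
                (pow2_ge_0 _)) as K; cbv zeta in K.
  rewrite <- Ek, <- Eb, <- Ef in K; fold (c (sn k (w * x) ^ 2)) in K.
  replace (- (_ + _) / 3) with r in K by lra.
  assert (Ea : sqrt a4 ^ 2 = a4) by (apply pow2_sqrt; lra).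
  (* Occurrences 4 and 5 are the factors [a4] in the two powers of [y]; afterwards [y] is visibly
     the square of [sqrt a4 * f (w * x)]. *)
  rewrite <- Ea in K at 4 5.
  transitivity (sqrt a4 * f (w * x) * (w ^ 2 * c (sn k (w * x) ^ 2))); [ring|].
  replace (w ^ 2 * c (sn k (w * x) ^ 2)) with
    (/ s * (a4 * (alpha3 r a4 - alpha1 r a4) / 3 * c (sn k (w * x) ^ 2)))
    by (rewrite Ew; field; lra).
  rewrite K; unfold accel; field; lra.
- rewrite Rmult_0_r; unfold f1, sn; rewrite am_0, sin_0 by assumption.
  unfold Rdiv; ring.
Qed.

Lemma dnoidal_sqr (r s a4 x : R) (Hr : 0 < r) (Ha : alpha4_range r a4) :
  let S := sn (kpar r a4) (freq r s a4 * x) ^ 2 in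
  dnoidal r s a4 x ^ 2 = a4 * ((1 - kpar r a4 ^ 2 * S) / (1 + beta2 r a4 * S)).
Proof.
intros S; rewrite dnoidal_profile, Rpow_mult_distr, dn_ratio_sqr.
- destruct (alpha_relations r a4 Hr Ha); rewrite pow2_sqrt; [reflexivity|lra].
- now apply kpar_sqr_lt1.
- now apply Rlt_le, beta2_pos.
Qed.

Lemma dnoidal_pos (r s a4 x : R) (Hr : 0 < r) (Ha : alpha4_range r a4) :
  0 < dnoidal r s a4 x.
Proof.
destruct (alpha_relations r a4 Hr Ha).
pose proof (one_add_sn_ge1 (beta2 r a4) (kpar r a4) (freq r s a4 * x)
  (Rlt_le _ _ (beta2_pos r a4 Hr Ha))).
rewrite dnoidal_profile; apply Rmult_lt_0_compat; [apply sqrt_lt_R0; lra|].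
apply Rdiv_lt_0_compat.
- now apply dn_pos, kpar_sqr_lt1.
- apply sqrt_lt_R0; lra.
Qed.

Lemma dnoidal_le (r s a4 x : R) (Hr : 0 < r) (Ha : alpha4_range r a4) :
  dnoidal r s a4 x <= sqrt a4.
Proof.
destruct (alpha_relations r a4 Hr Ha).
pose proof (beta2_pos r a4 Hr Ha).
pose proof (sn_sqr_bounds (kpar r a4) (freq r s a4 * x)) as HS.
rewrite <- (sqrt_pow2 (dnoidal r s a4 x)) by now apply Rlt_le, dnoidal_pos.
apply sqrt_le_1_alt; rewrite dnoidal_sqr by assumption.
set (S := sn _ _ ^ 2) in *.
pose proof (Rmult_le_pos _ _ (pow2_ge_0 (kpar r a4)) (proj1 HS)).
pose proof (Rmult_le_pos _ _ (Rlt_le _ _ H1) (proj1 HS)).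
apply Rle_trans with (a4 * 1); [|lra].
apply Rmult_le_compat_l; [lra|]; apply Rle_div_l; lra.
Qed.

Lemma dnoidal_0 (r s a4 : R) (Hr : 0 < r) (Ha : alpha4_range r a4) :
  dnoidal r s a4 0 = sqrt a4.
Proof.
rewrite dnoidal_profile, Rmult_0_r; unfold dn, sn.
rewrite am_0, sin_0 by now apply kpar_sqr_lt1.
replace (1 - kpar r a4 ^ 2 * 0 ^ 2) with 1 by ring.
replace (1 + beta2 r a4 * 0 ^ 2) with 1 by ring.
rewrite sqrt_1; field.
Qed.

(** The profile depends on [sn] only through its square, so its period in [u] is twice the complete
    integral [ellF k (PI / 2)], half the period of [sn]. *)
Definition dnoidal_period (r s a4 : R) : R :=
  2 * ellF (kpar r a4) (PI / 2) / freq r s a4.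

Lemma dnoidal_periodic (r s a4 x : R) (Hr : 0 < r) (Hs : 0 < s) (Ha : alpha4_range r a4) :
  dnoidal r s a4 (x + dnoidal_period r s a4) = dnoidal r s a4 x.
Proof.
pose proof (freq_pos r s a4 Hr Hs Ha).
rewrite !dnoidal_profile; unfold dn, sn.
replace (freq r s a4 * (x + dnoidal_period r s a4))
  with (freq r s a4 * x + 2 * ellF (kpar r a4) (PI / 2))
  by (unfold dnoidal_period; field; lra).
rewrite am_add_period, neg_sin by now apply kpar_sqr_lt1.
now rewrite <- !(Rsqr_pow2 (- _)), <- Rsqr_neg, !Rsqr_pow2.
Qed.

Lemma dnoidal_period_pos (r s a4 : R) (Hr : 0 < r) (Hs : 0 < s) (Ha : alpha4_range r a4) :
  0 < dnoidal_period r s a4.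
Proof.
pose proof PI_RGT_0.
pose proof (ellF_expanding (kpar r a4) 0 (PI / 2) (kpar_sqr_lt1 r a4 Hr Ha) ltac:(lra)).
rewrite ellF_0 in H0.
apply Rdiv_lt_0_compat; [lra|now apply freq_pos].
Qed.

(** Used for minimality of the period. At the maximal value [(k ^ 2 + b) * S = 0], hence [sn]
    vanishes; a positive amplitude with zero sine is at least [PI], and [ellF k PI] is the full
    period in [u]. *)
Lemma dnoidal_crest (r s a4 x : R) (Hr : 0 < r) (Hs : 0 < s) (Ha : alpha4_range r a4)
  (Hx : 0 < x) (Hc : dnoidal r s a4 x = sqrt a4) : dnoidal_period r s a4 <= x.
Proof.
destruct (alpha_relations r a4 Hr Ha).
pose proof (kpar_sqr_lt1 r a4 Hr Ha) as Hk.
pose proof (beta2_pos r a4 Hr Ha) as Hb.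
pose proof (freq_pos r s a4 Hr Hs Ha) as Hw.
pose proof (dnoidal_sqr r s a4 x Hr Ha) as E; cbv zeta in E.
rewrite Hc, pow2_sqrt in E by lra.
pose proof (sn_sqr_bounds (kpar r a4) (freq r s a4 * x)) as HS.
assert (HS0 : sn (kpar r a4) (freq r s a4 * x) ^ 2 = 0).
{ set (S := sn _ _ ^ 2) in *; pose proof (pow2_ge_0 (kpar r a4)) as Hk0.
  set (k2 := kpar r a4 ^ 2) in *; set (b := beta2 r a4) in *.
  assert (Hd : 0 < 1 + b * S) by nra.
  apply (f_equal (fun z => z * (1 + b * S) / a4)) in E.
  replace (a4 * ((1 - k2 * S) / (1 + b * S)) * (1 + b * S) / a4)
    with (1 - k2 * S) in E by (field; lra).
  replace (a4 * (1 + b * S) / a4) with (1 + b * S) in E by (field; lra).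
  nra. }
assert (Hsin : sin (am (kpar r a4) (freq r s a4 * x)) = 0)
  by (unfold sn in HS0; nra).
assert (Hwx : 0 < freq r s a4 * x) by nra.
pose proof (ellF_am (kpar r a4) (freq r s a4 * x) Hk) as Et.
set (t := am _ _) in *.
assert (Ht : 0 < t).
{ destruct (Rle_dec t 0) as [L|L]; [|lra].
  pose proof (ellF_expanding (kpar r a4) t 0 Hk L); rewrite ellF_0 in *; lra. }
assert (Hpi : PI <= t).
{ destruct (Rle_dec PI t) as [L|L]; [exact L|].
  pose proof (sin_gt_0 t Ht ltac:(lra)); lra. }
pose proof (ellF_expanding (kpar r a4) PI t Hk Hpi) as Hm.
pose proof (ellF_add_PI (kpar r a4) 0 Hk) as Hp.
rewrite ellF_0, !Rplus_0_l in Hp.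
apply Rle_div_l; [exact Hw|]; lra.
Qed.

Lemma dnoidal_trough (r s a4 x : R) (Hr : 0 < r) (Hs : 0 < s) (Ha : alpha4_range r a4)
  (Hc : dnoidal r s a4 x ^ 2 = alpha3 r a4) :
  exists n : Z, x = dnoidal_period r s a4 / 2 + IZR n * dnoidal_period r s a4.
Proof.
destruct (alpha_relations r a4 Hr Ha).
pose proof (kpar_sqr_lt1 r a4 Hr Ha) as Hk.
pose proof (beta2_pos r a4 Hr Ha) as Hb.
pose proof (freq_pos r s a4 Hr Hs Ha) as Hw.
pose proof (dnoidal_sqr r s a4 x Hr Ha) as E; cbv zeta in E.
pose proof (sn_sqr_bounds (kpar r a4) (freq r s a4 * x)) as HS.
assert (HS0 : sn (kpar r a4) (freq r s a4 * x) ^ 2 = 1).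
{ rewrite Hc in E.
  pose proof (one_add_sn_ge1 (beta2 r a4) (kpar r a4) (freq r s a4 * x) (Rlt_le _ _ Hb)) as Hd.
  rewrite kpar_sqr, beta2_eq in * by assumption.
  set (S := sn _ _ ^ 2) in *.
  set (A := alpha1 r a4) in *; set (B := alpha3 r a4) in *.
  assert (Hd' : 0 < (B - A) + (a4 - B) * S) by nra.
  apply (f_equal (fun z => z * ((B - A) + (a4 - B) * S))) in E.
  replace (a4 * ((1 - - A * (a4 - B) / (a4 * (B - A)) * S) / (1 + (a4 - B) / (B - A) * S)) *
      (B - A + (a4 - B) * S)) with (a4 * (B - A) + A * (a4 - B) * S) in E
    by (field; repeat split; lra).
  (* The cleared equation factors; [a4 - B] and [B - A] are positive, so [S = 1]. *)
  assert (E' : (a4 - B) * (B - A) * (S - 1) = 0) by lra.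
  apply Rmult_integral in E' as [E'|]; [|lra].
  apply Rmult_integral in E' as [E'|E']; lra. }
assert (Hcos : cos (am (kpar r a4) (freq r s a4 * x)) = 0).
{ pose proof (cn_sqr (kpar r a4) (freq r s a4 * x)) as Q; unfold cn in Q; nra. }
apply cos_eq_0_0 in Hcos as [n Hn]; exists n.
pose proof (ellF_am (kpar r a4) (freq r s a4 * x) Hk) as Et.
rewrite Hn, Rplus_comm, ellF_add_IZR_PI in Et by exact Hk.
unfold dnoidal_period; apply (Rmult_eq_reg_l (freq r s a4)); [|lra].
rewrite <- Et; field; lra.
Qed.

(** * Extrema, the first integral, and identification with the profile *)

Lemma periodic_max (f : R -> R) (T : R) (Hf : forall x, continuity_pt f x)
  (HT : 0 < T) (Hper : forall x, f (x + T) = f x) :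
  exists M, forall x, f x <= f M.
Proof.
destruct (continuity_ab_maj f 0 T ltac:(lra) (fun c _ => Hf c)) as [M [HM _]].
exists M; intros x.
rewrite <- (periodic_IZR f T Hper (- Int_part (x / T)) x), opp_IZR; apply HM.
destruct (base_Int_part (x / T)) as [H1 H2].
set (n := IZR (Int_part (x / T))) in *.
assert (E : x = x / T * T) by (field; lra).
set (y := x / T) in *; split; nra.
Qed.

Lemma is_derive_at_max (f : R -> R) (x l : R) (Hd : is_derive f x l)
  (Hx : forall y, f y <= f x) : l = 0.
Proof.
apply is_derive_Reals in Hd.
exact (deriv_maximum f (x - 1) (x + 1) x (exist _ l Hd) ltac:(lra) ltac:(lra)
         (fun y _ _ => Hx y)).
Qed.

Lemma is_derive_at_min (f : R -> R) (x l : R) (Hd : is_derive f x l)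
  (Hx : forall y, f x <= f y) : l = 0.
Proof.
apply is_derive_opp in Hd.
assert (- l = 0); [|lra].
apply (is_derive_at_max _ x _ Hd); intros y; change (- f y <= - f x).
specialize (Hx y); lra.
Qed.

(** [P2] and [P4] are the divided differences of the cube and the fifth power; each of their
    monomials lies between [0] and the matching power of [c]. *)
Lemma accel_lipschitz (r s c a b : R) (Hs : 0 < s) (Ha : 0 <= a <= c) (Hb : 0 <= b <= c) :
  Rabs (accel r s a - accel r s b)
  <= (Rabs r + 3 * c ^ 2 + 5 * c ^ 4) / s * Rabs (a - b).
Proof.
pose (P2 := a ^ 2 + a * b + b ^ 2); pose (P4 := a ^ 4 + a ^ 3 * b + a ^ 2 * b ^ 2 + a * b ^ 3 + b ^ 4).
assert (Hm : forall m n, 0 <= a ^ m * b ^ n <= c ^ (m + n)).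
{ intros m n; rewrite pow_add.
  pose proof (pow_le a m (proj1 Ha)); pose proof (pow_le b n (proj1 Hb)).
  split; [now apply Rmult_le_pos|].
  apply Rmult_le_compat; auto; apply pow_incr; lra. }
assert (H2 : 0 <= P2 <= 3 * c ^ 2).
{ pose proof (Hm 2%nat 0%nat); pose proof (Hm 1%nat 1%nat); pose proof (Hm 0%nat 2%nat).
  unfold P2; simpl in *; lra. }
assert (H4 : 0 <= P4 <= 5 * c ^ 4).
{ pose proof (Hm 4%nat 0%nat); pose proof (Hm 3%nat 1%nat); pose proof (Hm 2%nat 2%nat).
  pose proof (Hm 1%nat 3%nat); pose proof (Hm 0%nat 4%nat).
  unfold P4; simpl in *; lra. }
replace (accel r s a - accel r s b) with ((r - P2 - P4) / s * (a - b))
  by (unfold accel, P2, P4; field; lra).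
rewrite Rabs_mult; apply Rmult_le_compat_r; [apply Rabs_pos|].
unfold Rdiv; rewrite Rabs_mult, (Rabs_pos_eq (/ s))
  by (apply Rlt_le, Rinv_0_lt_compat, Hs).
apply Rmult_le_compat_r; [apply Rlt_le, Rinv_0_lt_compat, Hs|].
pose proof (Rle_abs r); pose proof (Rabs_maj2 r).
apply Rabs_le; lra.
Qed.

Lemma solution_is_derive (r s : R) (phi : R -> R) (Hs : 0 < s) (Hphi : solution r s phi) (x : R) :
  is_derive phi x (Derive phi x) /\ is_derive (Derive phi) x (accel r s (phi x)).
Proof.
destruct Hphi as (H1 & H2 & H3); split; [now apply Derive_correct|].
replace (accel r s (phi x)) with (Derive (Derive phi) x); [now apply Derive_correct|].
specialize (H3 x); unfold accel.
replace ((r * phi x - (phi x ^ 3 + phi x ^ 5)) / s)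
  with (r / s * phi x - 1 / s * (phi x ^ 3 + phi x ^ 5)) by (field; lra).
lra.
Qed.

(** The derivative is [6 * phi'] times [s * phi'' + phi ^ 5 + phi ^ 3 - r * phi], which vanishes by
    the equation. *)
Lemma first_integral (r s : R) (phi : R -> R) (Hs : 0 < s) (Hphi : solution r s phi) (x y : R) :
  let P z := 3 * s * Derive phi z ^ 2
             + ((phi z ^ 2) ^ 3 + 3 / 2 * (phi z ^ 2) ^ 2 - 3 * r * phi z ^ 2) in
  P x = P y.
Proof.
intros P; apply (zero_derive_const P); intros z; unfold P.
destruct (solution_is_derive r s phi Hs Hphi z) as [H1 H2].
auto_derive; [repeat split; eexists; eauto|].
rewrite (is_derive_unique_eta _ _ _ H1), (is_derive_unique_eta _ _ _ H2).
unfold accel; field; lra.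
Qed.

Lemma critical_values (r s : R) (phi : R -> R) (Hs : 0 < s) (Hphi : solution r s phi)
  (Hpos : forall x, 0 < phi x) (x y : R) (Hx : Derive phi x = 0) (Hy : Derive phi y = 0) :
  let u := phi x ^ 2 in let v := phi y ^ 2 in
  u = v \/ u ^ 2 + u * v + v ^ 2 + 3 / 2 * (u + v) = 3 * r.
Proof.
intros u v.
pose proof (first_integral r s phi Hs Hphi x y) as E; cbv beta zeta in E.
rewrite Hx, Hy in E; fold u v in E.
assert (K : (u - v) * (u ^ 2 + u * v + v ^ 2 + 3 / 2 * (u + v) - 3 * r) = 0) by lra.
apply Rmult_integral in K as [K|K]; [left|right]; lra.
Qed.

(** The endpoints are the solutions [C] of the relation in the limiting cases [B = C] (lower) and
    [B = 0] (upper). *)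
Lemma alpha4_range_of_trough (r C B : R) (Hr : 0 < r) (HB : 0 < B < C)
  (H : B ^ 2 + B * C + C ^ 2 + 3 / 2 * (B + C) = 3 * r) : alpha4_range r C.
Proof.
split.
- pose proof (sqrt_lt_of_lt_pow2 (2 * C + 1) (1 + 4 * r) ltac:(lra) ltac:(nra)); lra.
- pose proof (lt_sqrt_of_pow2_lt (4 * C + 3) (9 + 48 * r) ltac:(lra) ltac:(nra)); lra.
Qed.

(** For fixed [C] the relation is a quadratic in [B] whose roots, by Vieta, are [alpha1] and
    [alpha3]; positivity of [B] rules out the former. *)
Lemma alpha3_of_trough (r C B : R) (Hr : 0 < r) (HB : 0 < B < C)
  (H : B ^ 2 + B * C + C ^ 2 + 3 / 2 * (B + C) = 3 * r) : alpha3 r C = B.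
Proof.
destruct (alpha_relations r C Hr (alpha4_range_of_trough r C B Hr HB H))
  as (H1 & H2 & H3 & H4).
set (A := alpha1 r C) in *; set (B' := alpha3 r C) in *.
assert (E1 : (A + B') * C = (- (3 / 2) - C) * C) by (f_equal; lra).
assert (E2 : (A + B') * B = (- (3 / 2) - C) * B) by (f_equal; lra).
assert (K : (B - A) * (B - B') = 0) by lra.
apply Rmult_integral in K as [K|K]; lra.
Qed.

(** Moved to the origin, the crest has the value and the zero slope of the profile there. Both
    functions stay in the interval from [0] to [phi M], where [accel] is Lipschitz. *)
Lemma dnoidal_of_crest (r s a4 : R) (phi : R -> R) (Hr : 0 < r) (Hs : 0 < s)
  (Ha : alpha4_range r a4) (Hphi : solution r s phi) (Hpos : forall x, 0 < phi x)
  (M : R) (HM : forall x, phi x <= phi M) (HMa : phi M ^ 2 = a4) (x : R) :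
  phi (x + M) = dnoidal r s a4 x.
Proof.
destruct (dnoidal_ode r s a4 Hr Hs Ha) as (dD & HD & HdD & HD0).
pose proof (solution_is_derive r s phi Hs Hphi) as Hd.
assert (HMs : phi M = sqrt a4) by (rewrite <- HMa, sqrt_pow2; [|apply Rlt_le]; auto).
pose (K := (Rabs r + 3 * phi M ^ 2 + 5 * phi M ^ 4) / s).
apply (ode_unique (accel r s) (fun y => 0 <= y <= phi M) K) with
  (du := fun x => Derive phi (x + M)) (dv := dD) (u := fun x => phi (x + M)).
- pose proof (Rabs_pos r); pose proof (pow_le (phi M) 2 (Rlt_le _ _ (Hpos M))).
  pose proof (pow_le (phi M) 4 (Rlt_le _ _ (Hpos M))).
  apply Rmult_le_pos; [lra|apply Rlt_le, Rinv_0_lt_compat, Hs].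
- intros a b Ia Ib; now apply accel_lipschitz.
- intros t; destruct (Hd (t + M)) as [H _].
  auto_derive; [now eexists; eauto|]; rewrite (is_derive_unique_eta _ _ _ H); ring.
- intros t; destruct (Hd (t + M)) as [_ H].
  auto_derive; [now eexists; eauto|]; rewrite (is_derive_unique_eta _ _ _ H); ring.
- exact HD.
- exact HdD.
- intros t; split; [apply Rlt_le, Hpos|apply HM].
- intros t; split; [now apply Rlt_le, dnoidal_pos|].
  rewrite HMs; now apply dnoidal_le.
- rewrite Rplus_0_l, dnoidal_0 by assumption; exact HMs.
- rewrite Rplus_0_l, HD0; exact (is_derive_at_max phi M _ (proj1 (Hd M)) HM).
Qed.

Theorem proposition3p2 (c0 : R) (hc0 : 0 < c0 < 1) (phi : R -> R) :
  let r0 := 1 - c0 ^ 2 in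
  let s0 := 5 - 4 * c0 ^ 2 in
  solution r0 s0 phi ->
  (forall x, 0 < phi x) ->
  (forall x, phi (- x) = phi x) ->
  (exists T, period phi T) ->
  (* non-constant: the equilibrium is the excluded lower endpoint for [a4] *)
  (exists x y, phi x <> phi y) ->
  exists a4 : R, alpha4_range r0 a4 /\
    (* An even wave has a crest or a trough at the origin; in the second case
       it is the half-period translate of the profile, which is also even. *)
    ((forall x, phi x <= phi 0) /\ (forall x, phi x = dnoidal r0 s0 a4 x)
     \/
     (forall x, phi 0 <= phi x) /\
     exists L, fundamental_period phi L /\
       forall x, phi x = dnoidal r0 s0 a4 (x + L / 2)).
Proof.
intros r s Hphi Hpos Heven [T [HT Hper]] [x1 [x2 Hne]].
assert (Hr : 0 < r) by (unfold r; nra).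
assert (Hs : 0 < s) by (unfold s; nra).
clearbody r s.
pose proof (solution_is_derive r s phi Hs Hphi) as Hd.
assert (Hcont : forall x, continuity_pt phi x).
{ intros x; apply derivable_continuous_pt; exists (Derive phi x).
  apply is_derive_Reals, Hd. }
destruct (periodic_max phi T Hcont HT Hper) as [M HM].
destruct (periodic_max (fun x => - phi x) T) as [m Hm'].
{ intros x; now apply continuity_pt_opp. }
{ exact HT. }
{ intros x; now rewrite Hper. }
assert (Hm : forall x, phi m <= phi x) by (intros x; specialize (Hm' x); lra).
assert (HdM : Derive phi M = 0) by exact (is_derive_at_max phi M _ (proj1 (Hd M)) HM).
assert (Hdm : Derive phi m = 0) by exact (is_derive_at_min phi m _ (proj1 (Hd m)) Hm).
assert (Hd0 : Derive phi 0 = 0).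
{ assert (E : Derive phi 0 = - Derive phi 0); [|lra].
  rewrite <- (Derive_ext (fun x => phi (- x)) phi 0 Heven) at 1.
  apply is_derive_unique.
  destruct (Hd (- 0)) as [H _]; rewrite Ropp_0 in *.
  auto_derive; rewrite Ropp_0; [now eexists; eauto|].
  rewrite (is_derive_unique_eta _ _ _ H); ring. }
assert (Hlt : phi m < phi M).
{ destruct (Rle_lt_or_eq_dec _ _ (Hm M)) as [|E]; [assumption|].
  pose proof (Hm x1); pose proof (Hm x2); pose proof (HM x1); pose proof (HM x2).
  exfalso; apply Hne; lra. }
pose proof (Hpos m) as Hpm.
assert (HBC : 0 < phi m ^ 2 < phi M ^ 2) by nra.
assert (Hroot : (phi m ^ 2) ^ 2 + phi m ^ 2 * phi M ^ 2 + (phi M ^ 2) ^ 2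
                + 3 / 2 * (phi m ^ 2 + phi M ^ 2) = 3 * r).
{ destruct (critical_values r s phi Hs Hphi Hpos m M Hdm HdM); [lra|assumption]. }
pose proof (alpha4_range_of_trough r _ _ Hr HBC Hroot) as Ha.
pose proof (alpha3_of_trough r _ _ Hr HBC Hroot) as Hal3.
pose proof (dnoidal_of_crest r s _ phi Hr Hs Ha Hphi Hpos M HM eq_refl) as HD.
exists (phi M ^ 2); split; [exact Ha|].
pose proof (Hpos 0) as Hp0.
destruct (critical_values r s phi Hs Hphi Hpos 0 M Hd0 HdM) as [E|E].
- left.
  assert (E0 : phi 0 = phi M) by nra.
  assert (Hmax : forall x, phi x <= phi 0) by (intros x; rewrite E0; apply HM).
  split; [exact Hmax|]; intros x.
  (* The origin itself is now taken as the crest, in place of [M]. *)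
  rewrite <- (dnoidal_of_crest r s _ phi Hr Hs Ha Hphi Hpos 0 Hmax E).
  f_equal; ring.
- right.
  assert (E0 : phi 0 = phi m).
  (* The root relation for [0] and [M] minus the one for [m] and [M]; the second factor is
     positive. *)
  { assert (K : (phi 0 ^ 2 - phi m ^ 2) * (phi 0 ^ 2 + phi m ^ 2 + phi M ^ 2 + 3 / 2) = 0)
      by lra.
    apply Rmult_integral in K as [K|K]; nra. }
  split; [intros x; rewrite E0; apply Hm|].
  assert (HDx : forall x, phi x = dnoidal r s (phi M ^ 2) (x - M)).
  { intros x; rewrite <- HD; f_equal; ring. }
  set (L := dnoidal_period r s (phi M ^ 2)).
  assert (HL : forall x, dnoidal r s (phi M ^ 2) (x + L) = dnoidal r s (phi M ^ 2) x)
    by (intros x; now apply dnoidal_periodic).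
  exists L; split; [split; [split|]|].
  + now apply dnoidal_period_pos.
  + intros x; rewrite (HDx (x + L)), (HDx x), <- (HL (x - M)); f_equal; ring.
  (* A period [T'] carries the crest [M] to another crest, so the profile attains [sqrt a4] at
     [T']. *)
  + intros T' [HT' Hper']; apply dnoidal_crest; auto.
    rewrite <- HD, Rplus_comm, Hper'.
    rewrite sqrt_pow2; [reflexivity|apply Rlt_le, Hpos].
  (* The trough of [phi] at [0] is a trough of the profile at [- M]; hence [- M] is [L / 2] up to a
     multiple of [L]. *)
  + destruct (dnoidal_trough r s (phi M ^ 2) (- M) Hr Hs Ha) as [n Hn].
    { rewrite Hal3, <- E0, (HDx 0); f_equal; f_equal; ring. }
    fold L in Hn; intros x.
    rewrite HDx, <- (periodic_IZR _ L HL n (x + L / 2)); f_equal; lra.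
Qed.
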